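(* Let $\mathcal X$ be a normed space (norm $|\cdot|$) and $\mathcal Y=\{1,\dots,C\}$. Let $p_{\mathcal Z}$ be a probability distribution on $\mathcal Z=\mathcal X\times\mathcal Y$ with marginal $p(\mathbf x)$ and class-conditional probabilities $\eta_c(\mathbf x)=p(y=c\mid \mathbf x)$, $c=1,\dots,C$. Fix selected points $\tilde{\mathbf x}_1,\dots,\tilde{\mathbf x}_b\in\mathcal X$ with labels $\tilde y_1,\dots,\tilde y_b$ (index set $\mathbf s=\{1,\dots,b\}$), and a fixed loss function $l(\cdot,\cdot;A_{\mathbf s}):\mathcal X\times\mathcal Y\to[0,L]$ (obtained from a learning algorithm $A_{\mathbf s}$ trained on the selected points). Assume: (i) for every $y\in\mathcal Y$, $\mathbf x\mapsto l(\mathbf x,y;A_{\mathbf s})$ is $\lambda^l$-Lipschitz; (ii) each $\eta_c$ is $\lambda^{\eta}$-Lipschitz; (iii) $l(\tilde{\mathbf x}_k,y;A_{\mathbf s})=0$ for all $k\in\mathbf s$ and all $y\in\mathcal Y$. Let $\{(\mathbf x_t,y_t)\}_{t=1}^n$ be i.i.d. samples from $p_{\mathcal Z}$, and define the Core-set loss $$\mathcal L(\mathbf s)=\Big|\frac1n\sum_{t=1}^n l(\mathbf x_t,y_t;A_{\mathbf s})-\frac1{|\mathbf s|}\sum_{k\in\mathbf s} l(\tilde{\mathbf x}_k,\tilde y_k;A_{\mathbf s})\Big|.$$ Then for every $\gamma\in(0,1)$, with probability at least $1-\gamma$ over the sample, $$\mathcal L(\mathbf s)\le \max_{k\in\mathbf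 s}\delta_{\mathbf s}(k)\cdot\big(\lambda^l+\lambda^{\eta}LC\big)+\sqrt{\frac{L^2\log(1/\gamma)}{2n}},$$ where $\delta_{\mathbf s}(k)=\mathbb E_{\mathbf x\sim\mathbb N_{\mathbf s}(k)}\big[|\mathbf x-\tilde{\mathbf x}_k|\big]$ (maximum taken over $k$ with $p(\pi(\mathbf x)=\tilde{\mathbf x}_k)>0$).
   Context: Nearest selected point: $\pi(\mathbf x)=\arg\min_{\tilde{\mathbf x}\in\{\tilde{\mathbf x}_1,\dots,\tilde{\mathbf x}_b\}}|\mathbf x-\tilde{\mathbf x}|$ (ties broken by a fixed rule). Coverage area of selected point $k\in\mathbf s$: $\mathbb N_{\mathbf s}(k)=\{\mathbf x\in\mathcal X:\pi(\mathbf x)=\tilde{\mathbf x}_k\}$. The notation $\mathbf x\sim\mathbb N_{\mathbf s}(k)$ means $\mathbf x$ is distributed according to the conditional distribution $p(\mathbf x\mid \pi(\mathbf x)=\tilde{\mathbf x}_k)$ of the marginal $p(\mathbf x)$ restricted to the coverage area. $\delta_{\mathbf s}(k)$ is called the average radial distance of $\tilde{\mathbf x}_k$. *)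

(* Defs.v *)
From HB Require Import structures.
From mathcomp Require Import all_boot all_order all_algebra.
From mathcomp Require Import all_classical all_reals all_analysis.
Set Implicit Arguments. Unset Strict Implicit. Unset Printing Implicit Defensive.
Import Order.TTheory GRing.Theory Num.Theory.
Import numFieldNormedType.Exports.
Local Open Scope classical_set_scope.
Local Open Scope ring_scope.

Definition Borel (T : topologicalType) : set (set T) := <<s open >>.

Definition BorelZ (T : topologicalType) (C : nat) : set (set (T * 'I_C)) :=
  <<s [set B | exists A (S : set 'I_C), Borel A /\ B = A `*` S] >>.

Definition mutually_independent d (Omega : measurableType d) (R : realType)
  (P : probability Omega R) (T : topologicalType) (C n : nat)
  (Z : 'I_n -> Omega -> T * 'I_C) : Prop :=
  forall B : 'I_n -> set (T * 'I_C), (forall t, BorelZ (B t)) ->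
    P (\bigcap_t (Z t @^-1` B t)) = (\prod_(t < n) P (Z t @^-1` B t))%E.

Definition cover_event (Omega : Type) (T : Type) (b : nat) (pi : T -> 'I_b)
  (Xt : Omega -> T) (k : 'I_b) : set Omega := Xt @^-1` (pi @^-1` [set k]).

(* Average radial distance delta_s(k) = E_{x ~ N_s(k)} |x - x~_k|
   = E[ |X - x~_k| 1{pi(X) = k} ] / P(pi(X) = k), where X ~ p (the marginal),
   realised here as the law of the random point Xt. Extended-real valued
   (it may be +oo if the first moment is infinite). *)
Definition avg_radial_dist d (Omega : measurableType d) (R : realType)
  (P : probability Omega R) (X : normedModType R) (b : nat)
  (xs : 'I_b -> X) (pi : X -> 'I_b) (Xt : Omega -> X) (k : 'I_b) : \bar R :=
  ((\int[P]_(w in cover_event pi Xt k) (`|Xt w - xs k|)%:E)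
     * ((fine (P (cover_event pi Xt k)))^-1)%:E)%E.

Definition max_radial_dist d (Omega : measurableType d) (R : realType)
  (P : probability Omega R) (X : normedModType R) (b : nat)
  (xs : 'I_b -> X) (pi : X -> 'I_b) (Xt : Omega -> X) : \bar R :=
  (\big[maxe/0%E]_(k < b | (0 < P (cover_event pi Xt k))%E)
      avg_radial_dist P xs pi Xt k)%E.

Definition coreset_loss (R : realType) (X : Type) (C b n : nat)
  (l : X -> 'I_C -> R) (xs : 'I_b -> X) (ys : 'I_b -> 'I_C)
  (xsmp : 'I_n -> X) (ysmp : 'I_n -> 'I_C) : R :=
  `| n%:R^-1 * \sum_(t < n) l (xsmp t) (ysmp t)
     - b%:R^-1 * \sum_(k < b) l (xs k) (ys k) |.

(* Main.v *)
(** Since the loss vanishes at the selected points, the Lipschitz condition gives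
    l(x, y) <= lam_l |x - x~_pi(x)| for every label y; splitting the expectation
    over the coverage areas, E l(x_t, y_t) <= lam_l * max_k delta_s(k). The second
    average in the Core-set loss is 0, so the excess of the empirical mean over
    that bound is controlled by the one-sided Hoeffding inequality for independent
    variables with values in [0, L]. The term lam_eta * L * C is only slack. *)

Require Import Defs.
From HB Require Import structures.
From mathcomp Require Import all_boot all_order all_algebra.
From mathcomp Require Import all_classical all_reals all_analysis.
From mathcomp Require Import measurable_realfun ring lra.
Set Implicit Arguments. Unset Strict Implicit. Unset Printing Implicit Defensive.
Import Order.TTheory GRing.Theory Num.Theory.
Import numFieldNormedType.Exports.
Local Open Scope classical_set_scope.
Local Open Scope ring_scope.

(** * Exponential moments of bounded random variables *)

Lemma is_derive_ge0_le (R : realType) (f df : R -> R) (a b : R) :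
  (forall x : R, is_derive x 1 f (df x)) -> (forall x, a <= x -> 0 <= df x) ->
  a <= b -> f a <= f b.
Proof.
move=> fdf df0 ab; rewrite -subr_ge0.
have cf : {within `[a, b], continuous f}.
  by apply: derivable_within_continuous => x _; exact: ex_derive.
have [c cab ->] := MVT_segment ab (fun x _ => fdf x) cf.
by rewrite mulr_ge0 ?subr_ge0// df0// (itvP cab).
Qed.

(* With u = p e^x / (1 - p + p e^x) one has u' = u (1 - u) <= 1/4, hence
   u x <= p + x / 4, which is the sign of the derivative of
   (1 - p + p e^x) exp (- (p x + x^2 / 8)). *)
Lemma bernoulli_mgf_le (R : realType) (p h : R) : 0 <= p <= 1 -> 0 <= h ->
  1 - p + p * expR h <= expR (p * h + h ^+ 2 / 8).
Proof.
move=> /andP[p0 p1] h0.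
pose D : R -> R := cst (1 - p) + p \*: (@expR R).
have DE x : D x = 1 - p + p * expR x by [].
have D0 (x : R) : 0 < D x.
  rewrite DE; have e0 := expR_gt0 x.
  have [->|pn1] := eqVneq p 1; first by rewrite subrr add0r mul1r.
  have : p < 1 by rewrite lt_neqAle pn1.
  by move=> ?; have := mulr_ge0 p0 (ltW e0); lra.
have dD (x : R) : is_derive x 1 D (p * expR x).
  by apply: is_derive_eq; rewrite add0r.
pose u : R -> R := (p \*: (@expR R)) * (fun y => (D y)^-1).
have uE x : u x = p * expR x / D x by [].
have du (x : R) : is_derive x 1 u (u x * (1 - u x)).
  have Dx0 : D x != 0 by rewrite gt_eqF.
  have dV := is_deriveV Dx0 (dD x).
  apply: is_derive_eq; rewrite /= /GRing.scale /= uE.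
  by field.
have ule (x : R) : 0 <= x -> u x <= p + x / 4.
  move=> x0.
  pose v : R -> R := 4^-1 \*: id - u.
  suff : v 0 <= v x.
    have vE y : v y = y / 4 - u y by rewrite [y / 4]mulrC.
    by rewrite !vE uE DE expR0 mulr1 subrK divr1; lra.
  apply: (@is_derive_ge0_le R v (fun x => 4^-1 - u x * (1 - u x))) => // y.
    by apply: is_derive_eq; rewrite /= /GRing.scale /= mulr1.
  by move=> _; have := sqr_ge0 (u y - 2^-1); nra.
pose E : R -> R := - (p \*: id + 8^-1 \*: (id ^+ 2)).
have dE (x : R) : is_derive x 1 E (- (p + x / 4)).
  by apply: is_derive_eq; rewrite /= /GRing.scale /=; field.
pose G : R -> R := - (D * (@expR R \o E)).
have GE x : G x = - (D x * expR (E x)) by [].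
have dG (x : R) : is_derive x 1 G (D x * expR (E x) * (p + x / 4 - u x)).
  have dEx := is_derive1_comp (is_derive_expR (E x)) (dE x).
  apply: is_derive_eq; rewrite /= /GRing.scale /= uE.
  by have /lt0r_neq0 ? := D0 x; field.
have /(_ h0) : 0 <= h -> G 0 <= G h.
  apply: (is_derive_ge0_le dG) => x x0.
  by rewrite mulr_ge0 ?subr_ge0 ?ule// mulr_ge0 ?expR_ge0// ltW.
have EE x : E x = - (p * x + x ^+ 2 / 8) by rewrite [x ^+ 2 / 8]mulrC.
rewrite !GE lerN2 !EE expRN ler_pdivrMr ?expR_gt0// !DE expR0 mulr0 expr0n /=.
by rewrite mul0r addr0 oppr0 expR0 !mulr1 subrK mul1r.
Qed.

(** Hoeffding's lemma with only an upper bound [m] on the mean. By convexity [expR (s * x)] lies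
    below its chord on [[0, L]], so the extremal variable takes only the values [0] and [L], and
    [bernoulli_mgf_le] applies. Since [0 <= s], the true mean can then be raised to [m]. *)
Lemma expectation_expR_le d (Omega : measurableType d) (R : realType)
  (P : probability Omega R) (V : Omega -> R) (L m s : R) :
  measurable_fun setT V -> (forall w, 0 <= V w <= L) -> 0 < L -> 0 <= s ->
  (\int[P]_w (V w)%:E <= m%:E)%E ->
  (\int[P]_w (expR (s * V w))%:E <= (expR (s * m + (s * L) ^+ 2 / 8))%:E)%E.
Proof.
move=> mV VL L0 s0 Vm.
have V0 w : 0 <= V w by case/andP: (VL w).
have mEV : measurable_fun setT (EFin \o V) by exact/measurable_EFinP.
(* Slope of the chord of [expR (s * x)] between [x = 0] and [x = L]. *)
set c := (expR (s * L) - 1) / L.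
have sL0 : 0 <= s * L by rewrite mulr_ge0// ltW.
have expV w : expR (s * V w) <= 1 + c * V w.
  have t0 : 0 <= V w / L by rewrite divr_ge0// ltW.
  have t1 : V w / L <= 1 by rewrite ler_pdivrMr// mul1r; case/andP: (VL w).
  have := convex_expR (Itv01 t0 t1) (s * L) 0.
  rewrite !convRE /= expR0 mulr0 addr0 mulr1 mulrCA divfK ?gt_eqF//.
  by move/le_trans; apply; rewrite /c /unstable.onem; lra.
have c0 : 0 <= c.
  by rewrite divr_ge0 ?(ltW L0)// subr_ge0 -expR0 ler_expR.
have intV0 : (0 <= \int[P]_w (V w)%:E)%E.
  by apply: integral_ge0 => w _; rewrite lee_fin.
have intVL : (\int[P]_w (V w)%:E <= L%:E)%E.
  rewrite -[leRHS]mule1 -(@probability_setT _ _ _ P) -integral_cst//.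
  apply: ge0_le_integral => //; first by move=> w _; rewrite lee_fin.
  by move=> w _; rewrite lee_fin; case/andP: (VL w).
have intVE : (\int[P]_w (V w)%:E = (fine (\int[P]_w (V w)%:E))%:E)%E.
  by rewrite fineK// ge0_fin_numE// (le_lt_trans intVL)// ltry.
move: intV0 intVL Vm; rewrite intVE; set v := fine _; rewrite !lee_fin => v0 vL vm.
have int_affine : (\int[P]_w (1 + c * V w)%:E = (1 + c * v)%:E)%E.
  under eq_integral do rewrite EFinD EFinM.
  rewrite ge0_integralD//; last 2 first.
  - by move=> w _; rewrite lee_fin mulr_ge0.
  - by apply: measurable_funeM.
  rewrite ge0_integralZl_EFin//; last first.
  - by move=> w _; rewrite lee_fin.
  rewrite integral_cst// mul1e intVE -/v.
  exact: (congr1 (fun x => x + _)%E (probability_setT P)).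
apply: (@le_trans _ _ (1 + c * v)%:E).
  rewrite -int_affine; apply: ge0_le_integral => //.
  - by apply/measurable_EFinP; apply: measurableT_comp => //; exact: measurable_funM.
  - by apply/measurable_EFinP/measurable_funD => //; exact: measurable_funM.
  - by move=> w _; rewrite lee_fin.
have L0' : L != 0 by rewrite gt_eqF.
rewrite lee_fin; apply: (@le_trans _ _ (expR (v / L * (s * L) + (s * L) ^+ 2 / 8))).
  (* The mean of the chord is a Bernoulli moment generating function, with success probability
     [v / L] and parameter [s * L]. *)
  have -> : 1 + c * v = 1 - v / L + v / L * expR (s * L) by rewrite /c; field.
  apply: bernoulli_mgf_le => //.
  by rewrite divr_ge0// ?(ltW L0)//= ler_pdivrMr// mul1r.
by rewrite ler_expR lerD2r mulrCA divfK// ler_wpM2l.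
Qed.

(** * Independence: expectations of products and Hoeffding's tail bound *)

Section weighted.
Context d (Omega : measurableType d) (R : realType) (mu : {measure set Omega -> \bar R}).

Import HBNNSimple.

(** Monotone convergence along the simple approximations of [g], each expanded over its finite
    range. The resulting limit sees [W] only through its integrals over preimages under [V]. *)
Lemma ge0_integral_weight_limn d' (T : measurableType d') (V : Omega -> T) (W : Omega -> R) (g : T -> R)
    (mg : measurable_fun setT (EFin \o g)) :
  measurable_fun setT V -> measurable_fun setT W ->
  (forall w, 0 <= W w) -> (forall x, 0 <= g x) ->
  let g_ := nnsfun_approx measurableT mg in
  (\int[mu]_w (W w * g (V w))%:E)%E =
  limn (fun n => \sum_(r \in range (g_ n))
    (r%:E * \int[mu]_w (W w * \1_(g_ n @^-1` [set r]) (V w))%:E)%E).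
Proof.
move=> mV mW W0 g0 g_.
have mB n (r : R) : measurable_fun setT (fun w => W w * \1_(g_ n @^-1` [set r]) (V w)).
  apply: measurable_funM => //; apply: measurableT_comp mV.
  exact: measurable_indic.
have mgV n : measurable_fun setT (fun w => W w * g_ n (V w)).
  by apply: measurable_funM => //; exact: measurableT_comp.
transitivity (limn (fun n => \int[mu]_w (W w * g_ n (V w))%:E)%E).
  rewrite -monotone_convergence//.
  - apply: eq_integral => w _; apply/esym/cvg_lim => //=.
    rewrite EFinM; under eq_fun do rewrite EFinM.
    apply: cvgeZl => //.
    have g0' x : setT x -> (0 <= (EFin \o g) x)%E by rewrite lee_fin.
    exact: (cvg_nnsfun_approx measurableT mg g0' (x := V w)).
  - by move=> n; exact/measurable_EFinP.
  - by move=> n w _; rewrite lee_fin mulr_ge0.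
  - move=> w _ m n mn; rewrite lee_fin ler_wpM2l//.
    exact/lefP/nd_nnsfun_approx.
apply: congr_lim; apply/funext => n /=.
transitivity (\int[mu]_w (\sum_(r \in range (g_ n)) (r * (W w * \1_(g_ n @^-1` [set r]) (V w)))%:E)%E)%E.
  apply: eq_integral => w _.
  rewrite (fimfunE (g_ n)) fsumEFin//.
  rewrite mulr_fsumr; congr EFin; apply: eq_fsbigr => r _.
  by rewrite mulrCA.
rewrite ge0_integral_fsum//.
- apply: eq_fsbigr => r /[!inE] -[x _ <-].
  under eq_integral do rewrite EFinM.
  rewrite ge0_integralZl_EFin//; last exact/measurable_EFinP.
  by move=> w _; rewrite lee_fin mulr_ge0.
- by move=> r; apply/measurable_EFinP; exact: measurable_funM.
- move=> r w _; rewrite mulrCA EFinM mule_ge0 ?lee_fin//.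
  exact: nnfun_muleindic_ge0.
Qed.
(** The last hypothesis says that [V] pushes the measures with densities [W1] and [W2] forward to
    the same measure. In [integral_prod_indep] this takes an identity from indicators to nonnegative
    functions. *)
Lemma eq_ge0_integral_weight d' (T : measurableType d') (V : Omega -> T)
    (W1 W2 : Omega -> R) (g : T -> R) :
  measurable_fun setT V ->
  measurable_fun setT W1 -> (forall w, 0 <= W1 w) ->
  measurable_fun setT W2 -> (forall w, 0 <= W2 w) ->
  measurable_fun setT g -> (forall x, 0 <= g x) ->
  (forall B, measurable B ->
    \int[mu]_w (W1 w * \1_B (V w))%:E = \int[mu]_w (W2 w * \1_B (V w))%:E)%E ->
  (\int[mu]_w (W1 w * g (V w))%:E = \int[mu]_w (W2 w * g (V w))%:E)%E.
Proof.
move=> mV mW1 W10 mW2 W20 /measurable_EFinP mg g0 W12.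
rewrite !(ge0_integral_weight_limn mg)//; apply: congr_lim.
by apply/funext => n; apply: eq_fsbigr => r _; rewrite W12.
Qed.

End weighted.

(* Independence is the case where all h t are indicators; the induction on k lets
   the first k of the functions be arbitrary. *)
Lemma integral_prod_indep d (Omega : measurableType d) (R : realType)
    (P : probability Omega R) d' (T : measurableType d') n
    (V : 'I_n -> Omega -> T) (h : 'I_n -> T -> R) :
  (forall t, measurable_fun setT (V t)) ->
  (forall B : 'I_n -> set T, (forall t, measurable (B t)) ->
    P (\bigcap_t (V t @^-1` B t)) = \prod_(t < n) P (V t @^-1` B t))%E ->
  (forall t, measurable_fun setT (h t)) -> (forall t x, 0 <= h t x) ->
  (forall t, \int[P]_w (h t (V t w))%:E < +oo)%E ->
  (\int[P]_w (\prod_(t < n) h t (V t w))%:E =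
   \prod_(t < n) \int[P]_w (h t (V t w))%:E)%E.
Proof.
move=> mV indep.
have mpre t B : measurable B -> measurable (V t @^-1` B).
  by move=> mB; rewrite -[X in measurable X]setTI; exact: mV.
have int_indic t B : measurable B -> (\int[P]_w (\1_B (V t w))%:E = P (V t @^-1` B))%E.
  move=> mB; transitivity (\int[P]_w (\1_(V t @^-1` B) w)%:E)%E => //.
  by rewrite integral_indic ?setIT//; exact: mpre.
suff H k : forall h : 'I_n -> T -> R,
  (forall t, measurable_fun setT (h t)) -> (forall t x, 0 <= h t x) ->
  (forall t, \int[P]_w (h t (V t w))%:E < +oo)%E ->
  (forall t : 'I_n, (k <= t)%N -> exists2 B, measurable B & h t = \1_B) ->
  (\int[P]_w (\prod_(t < n) h t (V t w))%:E =
   \prod_(t < n) \int[P]_w (h t (V t w))%:E)%E.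
  by move=> mh h0 hoo; apply: (H n) => // t; rewrite leqNgt ltn_ord.
elim: k => [|k IH] {}h mh h0 hoo hk.
  have /choice[B hB] t : exists B, measurable B /\ h t = \1_B.
    by have [B mB ->] := hk t isT; exists B.
  have mB t := (hB t).1.
  under [RHS]eq_bigr do rewrite (hB _).2 int_indic//.
  rewrite -indep//.
  have mcap : measurable (\bigcap_t V t @^-1` B t).
    by apply: fin_bigcap_measurable => // t _; exact: mpre.
  transitivity (\int[P]_w (\1_(\bigcap_t V t @^-1` B t) w)%:E)%E; last first.
    by rewrite integral_indic ?setIT.
  apply: eq_integral => w _; congr EFin.
  under eq_bigr do rewrite (hB _).2 indicE.
  rewrite indicE; have [/set_mem wB|wB] := boolP (w \in _).
    by rewrite big1// => t _; rewrite mem_set//; exact: wB.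
  have [t wBt] : exists t, ~ B t (V t w).
    by apply/existsNP => wB'; move/negP: wB; apply; rewrite inE => t _; exact: wB'.
  by rewrite (bigD1 t)//= memNset// mul0r.
have [nk|kn] := leqP n k.
  by apply: IH => // t kt; apply: hk; have := ltn_ord t; rewrite ltnNge (leq_trans nk).
pose o := Ordinal kn.
(* To pass from an indicator at [o] to an arbitrary [h o], all other factors are frozen into the
   weight [W]; [C] is the product of their expectations. *)
pose W w := \prod_(t < n | t != o) h t (V t w).
pose C := (\prod_(t < n | t != o) \int[P]_w (h t (V t w))%:E)%E.
have ih0 t : (0 <= \int[P]_w (h t (V t w))%:E)%E.
  by apply: integral_ge0 => w _; rewrite lee_fin.
have Cfin : C \is a fin_num.
  by apply: prode_fin_num => t _; rewrite ge0_fin_numE.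
have C0 : (0 <= C)%E by apply: prode_ge0.
(* The induction hypothesis with [h o] replaced by [\1_B]: on events of [V o], the weight [W]
   integrates like the constant [C]. *)
have WC B : measurable B -> (\int[P]_w (W w * \1_B (V o w))%:E =
    \int[P]_w (fine C * \1_B (V o w))%:E)%E.
  move=> mB.
  pose hB t := if t == o then \1_B else h t.
  have hBo t : t != o -> hB t = h t by rewrite /hB => /negbTE ->.
  have hBoE : hB o = \1_B by rewrite /hB eqxx.
  transitivity (\int[P]_w (\prod_(t < n) hB t (V t w))%:E)%E.
    apply: eq_integral => w _; rewrite (bigD1 o)//= hBoE mulrC.
    by congr (_ * _)%:E; apply: eq_bigr => t to; rewrite hBo.
  rewrite IH.
  - rewrite (bigD1 o)//= hBoE int_indic//.
    under eq_bigr => t to do rewrite hBo//.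
    rewrite -/C.
    under [RHS]eq_integral do rewrite EFinM.
    rewrite ge0_integralZl_EFin ?fine_ge0//.
    + by rewrite fineK// int_indic// muleC.
    + by apply/measurable_EFinP; exact: measurableT_comp.
  - by move=> t; rewrite /hB; case: ifP.
  - by move=> t x; rewrite /hB; case: ifP.
  - move=> t; rewrite /hB; case: ifP => // _.
    by rewrite int_indic// (le_lt_trans (probability_le1 _ _)) ?ltry//; exact: mpre.
  - move=> t; rewrite leq_eqVlt => /predU1P[kt|kt].
      by exists B => //; rewrite /hB (_ : t = o) ?eqxx//; exact: val_inj.
    by have [B' mB' hB'] := hk _ kt; exists B' => //; rewrite hBo// -val_eqE/= gtn_eqF.
transitivity (\int[P]_w (W w * h o (V o w))%:E)%E.
  by apply: eq_integral => w _; rewrite (bigD1 o)//= mulrC.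
rewrite (eq_ge0_integral_weight _ _ _ _ _ _ _ WC)//.
- under eq_integral do rewrite EFinM.
  rewrite ge0_integralZl_EFin ?fine_ge0//.
  + by rewrite fineK// [RHS](bigD1 o)//= muleC.
  + by move=> w _; rewrite lee_fin.
  + by apply/measurable_EFinP; exact: measurableT_comp.
- have -> : W = fun w => \prod_(t < n) (if t != o then h t (V t w) else 1).
    by apply/funext => w; rewrite /W big_mkcond.
  apply: measurable_prod => t _; case: (t != o) => //.
  exact: measurableT_comp.
- by move=> w; exact: prodr_ge0.
- by move=> _; rewrite fine_ge0.
Qed.

(** Chernoff's bound: independence factors the moment generating function of the sum, and
    [expectation_expR_le] bounds each factor. *)
Lemma hoeffding_upper_tail d (Omega : measurableType d) (R : realType)
    (P : probability Omega R) n (V : 'I_n -> Omega -> R) (L m eps : R) :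
  (forall t, measurable_fun setT (V t)) ->
  (forall B : 'I_n -> set R, (forall t, measurable (B t)) ->
    P (\bigcap_t (V t @^-1` B t)) = \prod_(t < n) P (V t @^-1` B t))%E ->
  (forall t w, 0 <= V t w <= L) -> 0 < L ->
  (forall t, \int[P]_w (V t w)%:E <= m%:E)%E -> 0 < eps ->
  (P [set w | (n%:R * (m + eps) <= \sum_(t < n) V t w)%R] <=
   (expR (- (2 * n%:R * eps ^+ 2 / L ^+ 2)))%:E)%E.
Proof.
move=> mV indep VL L0 Vm eps0.
have mX : measurable_fun setT (fun w => \sum_(t < n) V t w) by exact: measurable_sum.
pose X : {RV P >-> R} := HB.pack (fun w => \sum_(t < n) V t w)
  (isMeasurableFun.Build _ _ _ _ (fun w => \sum_(t < n) V t w) mX).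
(* The minimiser of the exponent [n * (s ^ 2 * L ^ 2 / 8 - s * eps)] left after [m] cancels; the
   minimum is [- 2 * n * eps ^ 2 / L ^ 2]. *)
pose s := 4 * eps / L ^+ 2.
have s0 : 0 < s by rewrite divr_gt0 ?exprn_gt0 ?mulr_gt0.
apply: le_trans (chernoff X (n%:R * (m + eps)) s0) _.
have mgf t := expectation_expR_le (mV t) (VL t) L0 (ltW s0) (Vm t).
have int0 t : (0 <= \int[P]_w (expR (s * V t w))%:E)%E.
  by apply: integral_ge0 => w _; rewrite lee_fin expR_ge0.
have intoo t : (\int[P]_w (expR (s * V t w))%:E < +oo)%E.
  by apply: le_lt_trans (mgf t) _; rewrite ltry.
have -> : 'M_P X s = (\prod_(t < n) \int[P]_w (expR (s * V t w))%:E)%E.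
  rewrite /mmt_gen_fun unlock.
  rewrite -(@integral_prod_indep _ _ _ _ _ _ _ V (fun _ x => expR (s * x)))//.
  - apply: eq_integral => w _; congr EFin => /=.
    by rewrite -expR_sum -mulr_sumr mulrC.
  - by move=> t; apply: measurableT_comp => //; exact: measurable_funM.
have prodle : (\prod_(t < n) \int[P]_w (expR (s * V t w))%:E <=
    (expR (s * m + (s * L) ^+ 2 / 8) ^+ n)%:E)%E.
  pose I t := fine (\int[P]_w (expR (s * V t w))%:E)%E.
  have IE t : (\int[P]_w (expR (s * V t w))%:E = (I t)%:E)%E.
    by rewrite /I fineK// ge0_fin_numE.
  under eq_bigr do rewrite IE.
  rewrite prodEFin lee_fin -[X in _ ^+ X]card_ord -prodr_const.
  by apply: ler_prod => t _; rewrite -!lee_fin -IE int0 mgf.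
apply: le_trans (lee_wpmul2r _ prodle) _; first by rewrite lee_fin expR_ge0.
rewrite -EFinM lee_fin -expRM_natl -expRD ler_expR le_eqVlt; apply/orP; left.
by apply/eqP; rewrite /s; have := lt0r_neq0 L0 => ?; field.
Qed.

(** * Finite partitions and Borel measurability *)

Lemma measurable_fun_fin_pieces d (T : measurableType d) d' (U : measurableType d') n
    (q : T -> 'I_n) (g : 'I_n -> T -> U) :
  (forall k, measurable (q @^-1` [set k])) ->
  (forall k, measurable_fun setT (g k)) ->
  measurable_fun setT (fun x => g (q x) x).
Proof.
move=> mq mg _ B mB; rewrite setTI.
rewrite [X in measurable X](_ : _ =
    \bigcup_k (q @^-1` [set k] `&` (g k @^-1` B))); last first.
  by apply/seteqP; split => [x Bx|x [k _ [/= <-]]]//; exists (q x).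
apply: fin_bigcup_measurable => // k _; apply: measurableI => //.
by rewrite -[X in measurable X]setTI; exact: mg.
Qed.

Lemma ge0_integral_fin_pieces d (T : measurableType d) (R : realType)
    (mu : {measure set T -> \bar R}) n (q : T -> 'I_n) (f : T -> \bar R) :
  (forall k, measurable (q @^-1` [set k])) ->
  measurable_fun setT f -> (forall x, 0 <= f x)%E ->
  (\int[mu]_x f x = \sum_(k < n) \int[mu]_(x in q @^-1` [set k]) f x)%E.
Proof.
move=> mq mf f0.
have qT : \big[setU/set0]_(k < n) q @^-1` [set k] = setT.
  by apply/seteqP; split => // x _; rewrite (bigD1 (q x))//=; left.
rewrite -qT ge0_integral_bigsetU//.
- exact: index_enum_uniq.
- by apply/trivIsetP => i j _ _ ij; apply/seteqP; split => // x [/= -> /eqP]; rewrite (negbTE ij).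
- by rewrite qT.
Qed.

Lemma continuous_measurable_Borel (T : ptopologicalType) (R : realType) (f : T -> R) :
  continuous f -> measurable_fun (setT : set (g_sigma_algebraType (@open T))) f.
Proof.
move=> /continuousP cf; apply: (measurability _ (RGenOpens.measurableE R)).
move=> _ [_ [a [b ->] <-]]; rewrite setTI; apply: sub_sigma_algebra.
exact/cf/interval_open.
Qed.

Lemma max_radial_dist_ge0 d (Omega : measurableType d) (R : realType)
    (P : probability Omega R) (X : normedModType R) b (xs : 'I_b -> X)
    (pi : X -> 'I_b) (Xt : Omega -> X) :
  (0 <= max_radial_dist P xs pi Xt)%E.
Proof. exact: bigmax_ge_id. Qed.

(** The expected distance is the average of the radial distances weighted by the probabilities of
    the coverage areas, and a weighted average is at most the maximum. *)
Lemma expectation_nearest_dist_le d (Omega : measurableType d) (R : realType)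
    (P : probability Omega R) (X : normedModType R) b (xs : 'I_b -> X)
    (pi : X -> 'I_b) (Xt : Omega -> X) :
  (forall k, measurable (cover_event pi Xt k)) ->
  (forall k, measurable_fun setT (fun w => `|Xt w - xs k|)) ->
  (\int[P]_w (`|Xt w - xs (pi (Xt w))|)%:E <= max_radial_dist P xs pi Xt)%E.
Proof.
move=> mcov mdist; set M := max_radial_dist _ _ _ _.
have M0 : (0 <= M)%E by exact: max_radial_dist_ge0.
have mnear : measurable_fun setT (fun w => `|Xt w - xs (pi (Xt w))|).
  exact: (@measurable_fun_fin_pieces _ _ _ _ _ (pi \o Xt) (fun k w => `|Xt w - xs k|)).
have mq k : measurable ((pi \o Xt) @^-1` [set k]) := mcov k.
rewrite (@ge0_integral_fin_pieces _ _ _ P _ (pi \o Xt))//; last first.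
- exact/measurable_EFinP.
have sumP : (\sum_(k < b) P (cover_event pi Xt k) = 1)%E.
  rewrite -(probability_setT P) -[RHS]mul1e -integral_cst//.
  rewrite (@ge0_integral_fin_pieces _ _ _ P _ (pi \o Xt))//.
  by apply: eq_bigr => k _; rewrite integral_cst// mul1e.
rewrite -[leRHS]mul1e -sumP ge0_sume_distrl//.
apply: lee_sum => k _.
rewrite -/(cover_event pi Xt k).
rewrite (eq_integral (fun w => (`|Xt w - xs k|)%:E)); last first.
  by move=> w /set_mem /= <-.
(* Null areas are excluded from the maximum, but the integral over them vanishes. *)
have [P0|Pn0] := eqVneq (P (cover_event pi Xt k)) 0%E.
  rewrite P0 mul0e null_set_integral//; apply/measurable_EFinP.
  exact: measurable_funS (mdist k).
have Pgt0 : (0 < P (cover_event pi Xt k))%E by rewrite lt0e Pn0 measure_ge0.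
have : (avg_radial_dist P xs pi Xt k <= M)%E.
  exact: (le_bigmax_cond 0%E (fun k => avg_radial_dist P xs pi Xt k) Pgt0).
move=> /(lee_wpmul2l (ltW Pgt0)); apply: le_trans.
have Pfin : P (cover_event pi Xt k) \is a fin_num by exact: fin_num_measure.
(* Multiplying by the probability of the area cancels the normalisation of the conditional mean. *)
rewrite /avg_radial_dist muleCA -[X in (_ * (X * _))%E](fineK Pfin) -EFinM.
by rewrite divff ?mule1// fine_eq0.
Qed.

(** * Transfer of independence, measurability and law from the sample to its losses *)

Lemma mutually_independent_comp d (Omega : measurableType d) (R : realType)
    (P : probability Omega R) (T : topologicalType) C n
    (Z : 'I_n -> Omega -> T * 'I_C) (f : T * 'I_C -> R) :
  mutually_independent P Z ->
  (forall B, measurable B -> BorelZ (f @^-1` B)) ->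
  forall B : 'I_n -> set R, (forall t, measurable (B t)) ->
    (P (\bigcap_t ((f \o Z t) @^-1` B t)) = \prod_(t < n) P ((f \o Z t) @^-1` B t))%E.
Proof. by move=> indep mf B mB; apply: (indep (fun t => f @^-1` B t)) => t; exact: mf. Qed.

Lemma BorelZ_preimage (R : realType) (T : ptopologicalType) C (l : T -> 'I_C -> R) B :
  (forall c, continuous (l ^~ c)) -> measurable B ->
  BorelZ ((fun z : T * 'I_C => l z.1 z.2) @^-1` B).
Proof.
move=> lc mB.
(* Slices by label, indexed by all natural numbers to form a countable union; [insub] makes the
   slices with [i >= C] empty. *)
pose F i := if insub i is Some c then (l ^~ c @^-1` B) `*` [set c] else set0.
rewrite (_ : _ @^-1` B = \bigcup_i F i); last first.
  apply/seteqP; split => [[x c] Bx|[x c] [i _]].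
    by exists (val c) => //; rewrite /F valK.
  by rewrite /F; case: insubP => // c' _ _ [/= Bx ->].
apply: sigma_algebra_bigcup => i; rewrite /F.
case: insub => [c|]; last exact: sigma_algebra0.
apply: sub_sigma_algebra; exists (l ^~ c @^-1` B), [set c]; split => //.
by rewrite -[X in Borel X]setTI; exact: (continuous_measurable_Borel (lc c)).
Qed.

Lemma lipschitz_continuous (R : realType) (X : normedModType R) (f : X -> R) (k : R) :
  (forall x y, `|f x - f y| <= k * `|x - y|) -> continuous f.
Proof.
move=> lip x; apply/cvgrPdist_lt => e e0.
(* The sign of [k] is unknown, so [k] is replaced by a positive upper bound. *)
have k0 : 0 < `|k| + 1 by rewrite ltr_pwDr.
near=> y; apply: le_lt_trans (lip _ _) _.
apply: (@le_lt_trans _ _ ((`|k| + 1) * `|x - y|)).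
  by rewrite ler_wpM2r// (le_trans (ler_norm k))// lerDl.
rewrite mulrC -ltr_pdivlMr//; near: y.
by apply/nbhs_normP; exists (e / (`|k| + 1)) => //=; rewrite divr_gt0.
Unshelve. all: by end_near. Qed.

(** Both sides are integrals of [f] against the common law on the Borel sets. This lets the radial
    distances computed from one sample index serve every index. *)
Lemma eq_integral_law d (Omega : measurableType d) (R : realType)
    (P : probability Omega R) (T : ptopologicalType) (X1 X2 : Omega -> T) (f : T -> \bar R) :
  (forall A, Borel A -> measurable (X1 @^-1` A)) ->
  (forall A, Borel A -> measurable (X2 @^-1` A)) ->
  (forall A, Borel A -> P (X1 @^-1` A) = P (X2 @^-1` A)) ->
  measurable_fun (setT : set (g_sigma_algebraType (@open T))) f -> (forall x, 0 <= f x)%E ->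
  (\int[P]_w f (X1 w) = \int[P]_w f (X2 w))%E.
Proof.
move=> mX1 mX2 X12 mf f0.
have mX (Y : Omega -> T) : (forall A, Borel A -> measurable (Y @^-1` A)) ->
    measurable_fun setT (Y : Omega -> g_sigma_algebraType (@open T)).
  by move=> mY _ A mA; rewrite setTI; exact: mY.
rewrite -[LHS](ge0_integral_pushforward (mX _ mX1) P measurableT mf)//.
rewrite -[RHS](ge0_integral_pushforward (mX _ mX2) P measurableT mf)//.
by apply: eq_measure_integral; [exact: mX | exact: mX | move=> ? ? A mA _; exact: X12].
Qed.

Theorem theorem2
  (R : realType) (X : normedModType R) (C b n : nat)
  (* selected points and their labels; s = {1,...,b} *)
  (xs : 'I_b -> X) (ys : 'I_b -> 'I_C)
  (* nearest-selected-point map with a fixed tie-breaking rule *)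
  (pi : X -> 'I_b)
  (Hpi : forall x (k : 'I_b), `|x - xs (pi x)| <= `|x - xs k|)
  (Hpi_meas : forall k : 'I_b, Borel (pi @^-1` [set k]))
  (* loss of the algorithm A_s, with values in [0, L] *)
  (l : X -> 'I_C -> R) (L : R)
  (Hl_range : forall x y, 0 <= l x y <= L)
  (* class-conditional probabilities eta_c(x) = p(y = c | x) *)
  (eta : 'I_C -> X -> R)
  (Heta_ge0 : forall c x, 0 <= eta c x)
  (Heta_sum : forall x, \sum_(c < C) eta c x = 1)
  (lam_l lam_eta : R)
  (* (i) *) (Hlip_l : forall y x x', `|l x y - l x' y| <= lam_l * `|x - x'|)
  (* (ii) *) (Hlip_eta : forall c x x', `|eta c x - eta c x'| <= lam_eta * `|x - x'|)
  (* (iii) *) (Hzero : forall (k : 'I_b) y, l (xs k) y = 0)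
  (* the sample (x_t, y_t), t = 1..n, as random elements on a probability space *)
  (d : measure_display) (Omega : measurableType d) (P : probability Omega R)
  (Xs : 'I_n -> Omega -> X) (Ys : 'I_n -> Omega -> 'I_C)
  (HXs_meas : forall t A, Borel A -> measurable (Xs t @^-1` A))
  (HYs_meas : forall t (c : 'I_C), measurable (Ys t @^-1` [set c]))
  (* identically distributed: common marginal p, and p(y = c | x) = eta_c(x) *)
  (Hmarg : forall t t' A, Borel A -> P (Xs t @^-1` A) = P (Xs t' @^-1` A))
  (Hcond : forall t (c : 'I_C) A, Borel A ->
     P (Xs t @^-1` A `&` Ys t @^-1` [set c])
     = (\int[P]_(w in Xs t @^-1` A) (eta c (Xs t w))%:E)%E)
  (* independent *)
  (Hindep : mutually_independent P (fun t w => (Xs t w, Ys t w)))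
  (Hn : (0 < n)%N) :
  forall gamma : R, 0 < gamma < 1 ->
  forall t0 : 'I_n,
  (P [set w | ((coreset_loss l xs ys (fun t => Xs t w) (fun t => Ys t w))%:E
               <= max_radial_dist P xs pi (Xs t0) * (lam_l + lam_eta * L * C%:R)%:E
                  + (Num.sqrt (L ^+ 2 * ln gamma^-1 / (2 * n%:R)))%:E)%E]
   >= (1 - gamma)%:E)%E.
Proof.
move=> gamma /andP[gamma0 gamma1] t0.
set M := max_radial_dist _ _ _ _; set K := lam_l + _; set eps := Num.sqrt _.
set ev := [set w | _].
have M0 : (0 <= M)%E by exact: max_radial_dist_ge0.
have eps0 : 0 <= eps by exact: sqrtr_ge0.
have l0 x y : 0 <= l x y by case/andP: (Hl_range x y).
have lnear x y : l x y <= lam_l * `|x - xs (pi x)|.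
  by rewrite -[l x y]ger0_norm// -[l x y]subr0 -(Hzero (pi x) y).
have lossE w : coreset_loss l xs ys (fun t => Xs t w) (fun t => Ys t w) =
    n%:R^-1 * \sum_(t < n) l (Xs t w) (Ys t w).
  rewrite /coreset_loss [X in _ - _ * X]big1 ?mulr0 ?subr0 => [|k _]; last exact: Hzero.
  by rewrite ger0_norm// mulr_ge0// sumr_ge0.
have evT : ev = setT -> ((1 - gamma)%:E <= P ev)%E.
  by move=> ->; rewrite probability_setT lee_fin gerBl ltW.
(* Degenerate cases are removed first: with a zero loss and a nonnegative bound, the event is the
   whole space. *)
have trivial_loss : (forall x y, l x y = 0) -> (0 <= M * K%:E)%E -> ((1 - gamma)%:E <= P ev)%E.
  move=> lE MK; apply: evT; apply/seteqP; split => // w _.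
  rewrite /ev /= lossE big1 ?mulr0 => [|t _]; last exact: lE.
  by rewrite adde_ge0// lee_fin.
(* On a one-point space the Lipschitz conditions do not fix the signs of the constants, so [K] may
   be negative; there all distances, hence [M], are zero. Otherwise two distinct points force both
   constants to be nonnegative. *)
have [X1|/existsNP[x0 /existsNP[x1 x01]]] := pselect (forall x x' : X, x = x').
  have d0 (x x' : X) : `|x - x'| = 0 by rewrite (X1 x x') subrr normr0.
  apply: trivial_loss => [x y|].
    by apply/eqP; rewrite eq_le l0 andbT (le_trans (lnear x y))// d0 mulr0.
  suff -> : M = 0%E by rewrite mul0e.
  apply: (big_ind (fun x => x = 0%E)) => [//|_ _ -> ->|k _]; first by rewrite maxxx.
  rewrite /avg_radial_dist (eq_integral (cst 0%E)) ?integral0 ?mul0e// => w _.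
  by rewrite d0.
have d01 : 0 < `|x0 - x1| by rewrite normr_gt0 subr_eq0; exact/eqP.
(* Some label is needed to use the Lipschitz conditions; the index [pi x0] supplies one. *)
pose c0 := ys (pi x0).
have lam_l0 : 0 <= lam_l.
  by rewrite -(pmulr_lge0 _ d01) (le_trans _ (Hlip_l c0 x0 x1)).
have lam_eta0 : 0 <= lam_eta.
  by rewrite -(pmulr_lge0 _ d01) (le_trans _ (Hlip_eta c0 x0 x1)).
have L0 : 0 <= L by case/andP: (Hl_range x0 c0); exact: le_trans.
have lam_le : lam_l <= K by rewrite lerDl !mulr_ge0.
have K0 : 0 <= K := le_trans lam_l0 lam_le.
have MK0 : (0 <= M * K%:E)%E by rewrite mule_ge0.
(* This case is split off so that [K] is positive below: if [M] is infinite then so is [M * K],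
   whereas [+oo * 0] would be [0]. *)
have [lam00|lamn0] := eqVneq lam_l 0.
  apply: trivial_loss => // x y; apply/eqP; rewrite eq_le l0 andbT.
  by rewrite (le_trans (lnear x y))// lam00 mul0r.
(* The Hoeffding exponent divides by [L ^+ 2]. *)
have [L00|Ln0] := eqVneq L 0.
  apply: trivial_loss => // x y; apply/eqP; rewrite eq_le l0 andbT.
  by case/andP: (Hl_range x y) => _; rewrite L00.
have lamgt0 : 0 < lam_l by rewrite lt0r lamn0.
have Lgt0 : 0 < L by rewrite lt0r Ln0.
have [Moo|Mfin] := eqVneq M +oo%E.
  apply: evT; apply/seteqP; split => // w _.
  by rewrite /ev /= Moo gt0_mulye ?lte_fin ?(lt_le_trans lamgt0)// addye// leey.
have {}Mfin : M \is a fin_num by rewrite ge0_fin_numE// lt_neqAle Mfin leey.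
have ngt0 : 0 < n%:R :> R by rewrite ltr0n.
have nn0 : n%:R != 0 :> R by rewrite gt_eqF.
have lngt0 : 0 < ln gamma^-1 by rewrite ln_gt0// invf_gt1.
have epsgt0 : 0 < eps by rewrite sqrtr_gt0 divr_gt0// mulr_gt0// exprn_gt0.
have l_cont c : continuous (l ^~ c) by apply: lipschitz_continuous; exact: Hlip_l.
have mXt t : measurable_fun setT (Xs t : Omega -> g_sigma_algebraType (@open X)).
  by move=> _ A mA; rewrite setTI; exact: HXs_meas.
pose V t w := l (Xs t w) (Ys t w).
have mV t : measurable_fun setT (V t).
  apply: (@measurable_fun_fin_pieces _ _ _ _ _ (Ys t) (fun c w => l (Xs t w) c)) => // c.
  exact: measurableT_comp (continuous_measurable_Borel (l_cont c)) (mXt t).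
have indepV : forall B : 'I_n -> set R, (forall t, measurable (B t)) ->
    (P (\bigcap_t (V t @^-1` B t)) = \prod_(t < n) P (V t @^-1` B t))%E.
  apply: (mutually_independent_comp Hindep (f := fun z => l z.1 z.2)) => B mB.
  exact: BorelZ_preimage.
have mdist k : measurable_fun (setT : set (g_sigma_algebraType (@open X)))
    (fun x => `|x - xs k|).
  apply: continuous_measurable_Borel; apply: (@lipschitz_continuous _ _ _ 1) => x y.
  rewrite mul1r (le_trans (ler_dist_dist _ _))//.
  by rewrite opprB addrA subrK.
have mnear : measurable_fun (setT : set (g_sigma_algebraType (@open X)))
    (fun x => `|x - xs (pi x)|).
  exact: (@measurable_fun_fin_pieces _ (g_sigma_algebraType (@open X)) _ _ _ pi (fun k x => `|x - xs k|)).
have EV t : (\int[P]_w (V t w)%:E <= (lam_l * fine M)%:E)%E.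
  rewrite EFinM fineK//.
  apply: (@le_trans _ _ (lam_l%:E * \int[P]_w (`|Xs t w - xs (pi (Xs t w))|)%:E)%E).
    have mnt : measurable_fun setT (fun w => (`|Xs t w - xs (pi (Xs t w))|)%:E).
      by apply/measurable_EFinP; exact: measurableT_comp mnear (mXt t).
    rewrite -ge0_integralZl_EFin//.
    apply: ge0_le_integral => //.
    - by move=> w _; rewrite lee_fin; exact: l0.
    - exact/measurable_EFinP.
    - exact: measurable_funeM.
    - by move=> w _; rewrite -EFinM lee_fin; exact: lnear.
  rewrite lee_wpmul2l ?lee_fin//.
  have /measurable_EFinP mnearE := mnear.
  (* The maximum is computed from the sample [t0], so the expectation is moved from [t] to [t0]. *)
  rewrite (eq_integral_law (HXs_meas t) (HXs_meas t0) (Hmarg t t0) mnearE); last first.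
    by move=> x; rewrite /= lee_fin.
  apply: expectation_nearest_dist_le => k; first exact: HXs_meas.
  exact: measurableT_comp (mdist k) (mXt t0).
have tail := hoeffding_upper_tail mV indepV (fun t w => Hl_range _ _) Lgt0 EV epsgt0.
have mS : measurable_fun setT (fun w => \sum_(t < n) V t w) by exact: measurable_sum.
have evE : ev = [set w | n%:R^-1 * \sum_(t < n) V t w <= fine M * K + eps].
  by apply/seteqP; split => w; rewrite /ev/= lossE -[M](fineK Mfin) -EFinM -EFinD lee_fin.
have mev : measurable ev.
  rewrite evE -[X in measurable X]setTI.
  rewrite (_ : [set w | _] = (fun w => n%:R^-1 * \sum_(t < n) V t w) @^-1`
    `]-oo, fine M * K + eps]); last by apply/seteqP; split => w /=; rewrite in_itv.
  by apply: measurable_funM => //; exact: measurable_itv.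
(* [eps] solves [2 * n * eps ^ 2 / L ^ 2 = ln (1 / gamma)]. *)
have gammaE : expR (- (2 * n%:R * eps ^+ 2 / L ^+ 2)) = gamma.
  rewrite sqr_sqrtr; last first.
    by rewrite divr_ge0 ?mulr_ge0 ?ltW// exprn_gt0.
  rewrite (_ : 2 * _ * _ / _ = ln gamma^-1); last by field; rewrite Ln0 nn0.
  by rewrite expRN lnK ?invrK ?posrE ?invr_gt0.
have : (P (~` ev) <= gamma%:E)%E.
  rewrite -gammaE; apply: le_trans tail; apply: le_measure; rewrite ?inE.
  - exact: measurableC.
  - rewrite -[X in measurable X]setTI.
    rewrite (_ : [set w | _] = (fun w => \sum_(t < n) V t w) @^-1`
      `[n%:R * (lam_l * fine M + eps), +oo[); last first.
      by apply/seteqP; split => w /=; rewrite in_itv/= andbT.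
    by apply: mS => //; exact: measurable_itv.
  (* Outside [ev] the empirical mean exceeds [fine M * K + eps], which is at least
     [lam_l * fine M + eps] because [lam_l <= K]; so the complement lies in the Hoeffding event. *)
  - rewrite evE => w /= /negP; rewrite -ltNge => /ltW.
    rewrite -(ler_pM2l ngt0) mulVKf//; apply: le_trans.
    by rewrite ler_pM2l// lerD2r mulrC ler_wpM2l// fine_ge0.
rewrite probability_setC//.
have Pfin : P ev \is a fin_num by exact: fin_num_measure.
by rewrite -(fineK Pfin) -EFinB !lee_fin; lra.
Qed.
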